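(* Let $A$ be a semi-hereditary ring. Suppose that there exists a prime ideal $P \in \operatorname{Spec} A$ such that every element of $P$ is a zero divisor in $A$. Then $P^2 = P$. Furthermore, if $P$ is finitely generated, then the following hold: (i) there exists an idempotent element $e \in P$ such that $P = (e)$; (ii) for this $e$, $A$ decomposes as $A \cong A/eA \times A/(1-e)A$; (iii) $A/eA$ is a Prüfer domain, and $A/(1-e)A$ is semi-hereditary.
   Context: All rings are commutative with identity. A ring $A$ is called semi-hereditary if every finitely generated ideal of $A$ is projective as an $A$-module. An integral domain $D$ is called a Prüfer domain if for every prime ideal $\mathfrak{p}$ of $D$ the localization $D_{\mathfrak{p}}$ is a valuation ring. The element $0$ is regarded as a zero divisor (i.e. ''zero divisor'' means an element that is not a non-zero-divisor). *)

(* Defs.v *)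
From HB Require Import structures.
From mathcomp Require Import all_boot all_algebra.
From mathcomp Require Import generic_quotient ring_quotient fraction.
From mathcomp Require Import boolp.
From mathcomp Require Import ring.

Set Implicit Arguments.
Unset Strict Implicit.
Unset Printing Implicit Defensive.

Import GRing.Theory.

Local Open Scope ring_scope.
Local Open Scope quotient_scope.

(* Unlike [idealr], this allows the unit ideal and the zero ring: A/(1-e)A is
   the zero ring when e = 0. Membership is boolean, which classically is no
   restriction on the subset. *)
HB.mixin Record isIdeal (A : comPzRingType) (S : A -> bool) := {
  ideal_mull : forall a, {in S, forall x, a * x \in S}
}.

#[short(type="ideal")]
HB.structure Definition Ideal (A : comPzRingType) :=
  {S of GRing.ZmodClosed A S & isIdeal A S}.

Section Ideals.
Variable A : comPzRingType.
Implicit Types (I J : ideal A) (s : seq A).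

Definition gen_pred s : {pred A} :=
  fun x => `[< exists c : nat -> A, x = \sum_(i < size s) c i * s`_i >].

Lemma gen_pred_zmod s : zmod_closed (gen_pred s).
Proof.
split=> [|x y /asboolP[c ->] /asboolP[d ->]]; apply/asboolP.
  by exists (fun=> 0); rewrite big1 // => i _; rewrite mul0r.
exists (fun i => c i - d i); rewrite -sumrB.
by apply: eq_bigr => i _; rewrite mulrBl.
Qed.

Lemma gen_pred_mull s a : {in gen_pred s, forall x, a * x \in gen_pred s}.
Proof.
move=> x /asboolP[c ->]; apply/asboolP; exists (fun i => a * c i).
by rewrite mulr_sumr; apply: eq_bigr => i _; rewrite mulrA.
Qed.

HB.instance Definition _ s :=
  GRing.isZmodClosed.Build A (gen_pred s) (gen_pred_zmod s).
HB.instance Definition _ s := isIdeal.Build A (gen_pred s) (@gen_pred_mull s).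

Definition gen_ideal s : ideal A := gen_pred s.

Definition principal_ideal (x : A) : ideal A := gen_ideal [:: x].

Definition finitely_generated I : Prop := exists s, I =i gen_ideal s.

Definition mul_ideal I J : {pred A} :=
  fun x => `[< exists (n : nat) (a b : 'I_n -> A),
    [/\ forall i, a i \in I, forall i, b i \in J & x = \sum_i a i * b i] >].

Definition prime_ideal I : Prop :=
  1 \notin I /\ forall x y : A, x * y \in I -> (x \in I) || (y \in I).

Definition ideal_regular I : {pred A^o} := fun x => (x : A) \in I.

Record ideal_module I := IdealModule {
  ideal_val :> A^o;
  _ : ideal_val \in ideal_regular I
}.
HB.instance Definition _ I := [isSub for @ideal_val I].
HB.instance Definition _ I := [Choice of ideal_module I by <:].

Lemma ideal_submod I : GRing.subsemimod_closed (ideal_regular I).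
Proof.
split; last by move=> a x; apply: (@ideal_mull A I a x).
by split=> [|x y]; [apply: (@rpred0 A I)|apply: (@rpredD A I)].
Qed.
HB.instance Definition _ I :=
  GRing.SubChoice_isSubLmodule.Build A A^o _ (ideal_module I) (ideal_submod I).

End Ideals.

Definition projective (A : comPzRingType) (M : lmodType A) : Prop :=
  forall (N N' : lmodType A) (g : {linear N -> N'}) (f : {linear M -> N'}),
    (forall y, exists x, g x = y) ->
  exists h : {linear M -> N}, forall x, g (h x) = f x.

Definition semi_hereditary (A : comPzRingType) : Prop :=
  forall I : ideal A, finitely_generated I -> projective (ideal_module I).

Definition zero_divisor (A : comPzRingType) (x : A) : Prop := ~ GRing.lreg x.

Definition ring_isomorphic (R S : pzRingType) : Prop :=
  exists f : {rmorphism R -> S}, bijective f.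

Section QuotientRing.
Variables (A : comPzRingType) (I : ideal A).

(* The library equips this quotient with a product only when [I] is proper. *)
Definition quot_ring : Type := @Quotient.quot A I.
HB.instance Definition _ := GRing.Zmodule.on quot_ring.
HB.instance Definition _ := ZmodQuotient.on quot_ring.

Definition quot_proj (x : A) : quot_ring := \pi_quot_ring x.
Definition quot_mul := lift_op2 quot_ring *%R.

Lemma quot_projP (x y : A) : reflect (quot_proj x = quot_proj y) (x - y \in I).
Proof. by rewrite (@Quotient.idealrBE A I); apply: eqP. Qed.

Lemma quot_projD : {morph quot_proj : x y / x + y}.
Proof. exact: (@pi_addr _ _ _ _ _ quot_ring). Qed.

Lemma quot_projM : {morph quot_proj : x y / x * y >-> quot_mul x y}.
Proof.
move=> x y; unlock quot_mul; rewrite -!/(quot_proj _).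
have Ir z : z - repr (quot_proj z) \in I by apply/quot_projP; rewrite [RHS]reprK.
apply/quot_projP; set x' : A := repr _; set y' : A := repr _.
have -> : x * y - x' * y' = x * (y - y') + y' * (x - x').
  by rewrite !mulrBr addrA [y' * x]mulrC subrK [y' * x']mulrC.
by apply: rpredD; apply: ideal_mull; apply: Ir.
Qed.

Lemma quot_projW (T : quot_ring -> Prop) :
  (forall x, T (quot_proj x)) -> forall u, T u.
Proof. by move=> Tproj u; rewrite -[u]reprK; apply: Tproj. Qed.

Lemma quot_mulA : associative quot_mul.
Proof.
elim/quot_projW=> x; elim/quot_projW=> y; elim/quot_projW=> z.
by rewrite -!quot_projM mulrA.
Qed.

Lemma quot_mulC : commutative quot_mul.
Proof.
by elim/quot_projW=> x; elim/quot_projW=> y; rewrite -!quot_projM mulrC.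
Qed.

Lemma quot_mul1 : left_id (quot_proj 1) quot_mul.
Proof. by elim/quot_projW=> x; rewrite -quot_projM mul1r. Qed.

Lemma quot_mulDl : left_distributive quot_mul +%R.
Proof.
elim/quot_projW=> x; elim/quot_projW=> y; elim/quot_projW=> z.
by rewrite -!(quot_projD, quot_projM) mulrDl.
Qed.

HB.instance Definition _ := GRing.Zmodule_isComPzRing.Build quot_ring
  quot_mulA quot_mulC quot_mul1 quot_mulDl.
End QuotientRing.

Section Localization.
Variables (A : comPzRingType) (S : mulrClosed A).

Definition prefrac : Type := (A * {s : A | s \in S})%type.
HB.instance Definition _ := Choice.on prefrac.
Implicit Types u v w : prefrac.

Definition prefrac_of (a s : A) (Ss : s \in S) : prefrac := (a, exist _ s Ss).
Definition num u : A := u.1.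
Definition den u : A := val u.2.

Lemma denP u : den u \in S. Proof. exact: (valP u.2). Qed.

(* The factor [t] is needed because [S] may contain zero divisors. *)
Definition loc_equiv u v : bool :=
  `[< exists2 t, t \in S & t * (num u * den v) = t * (num v * den u) >].

Lemma loc_equiv_class : equiv_class_of loc_equiv.
Proof.
split=> [u|u v|v u w].
- by apply/asboolP; exists 1; rewrite ?rpred1.
- by apply/asboolP/asboolP => -[t St tuv]; exists t.
move=> /asboolP[t St tuv] /asboolP[r Sr rvw]; apply/asboolP.
exists (t * r * den v); first by rewrite !rpredM ?denP.
transitivity (r * den w * (t * (num u * den v))); first by ring.
by rewrite tuv; transitivity (t * den u * (r * (num v * den w)));
  [ring | rewrite rvw; ring].
Qed.
Canonical loc_equiv_equiv := EquivRelPack loc_equiv_class.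
Canonical loc_equiv_encModRel := defaultEncModRel loc_equiv.

Definition localization : Type := {eq_quot loc_equiv}.
HB.instance Definition _ : EqQuotient _ loc_equiv localization :=
  EqQuotient.on localization.
HB.instance Definition _ := Choice.on localization.

Definition loc_frac u : localization := \pi_localization u.

Lemma loc_fracP u v :
  loc_frac u = loc_frac v <->
  exists2 t, t \in S & t * (num u * den v) = t * (num v * den u).
Proof. by split=> [/eqmodP/asboolP|uv]; last exact/eqmodP/asboolP. Qed.

Lemma loc_fracW (T : localization -> Prop) :
  (forall u, T (loc_frac u)) -> forall x, T x.
Proof. by move=> Tfrac x; rewrite -[x]reprK; apply: Tfrac. Qed.

Lemma loc_repr u : exists2 t, t \in S &
  t * (num u * den (repr (loc_frac u))) = t * (num (repr (loc_frac u)) * den u).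
Proof. by apply/loc_fracP; rewrite [RHS]reprK. Qed.

Definition prefrac_add u v : prefrac :=
  prefrac_of (num u * den v + num v * den u) (rpredM (denP u) (denP v)).
Definition prefrac_opp u : prefrac := prefrac_of (- num u) (denP u).
Definition prefrac_mul u v : prefrac :=
  prefrac_of (num u * num v) (rpredM (denP u) (denP v)).

Definition loc_add := lift_op2 localization prefrac_add.
Definition loc_opp := lift_op1 localization prefrac_opp.
Definition loc_mul := lift_op2 localization prefrac_mul.
Definition to_loc (a : A) : localization :=
  loc_frac (prefrac_of a (rpred1 S)).

Lemma loc_fracD : {morph loc_frac : u v / prefrac_add u v >-> loc_add u v}.
Proof.
move=> u v; unlock loc_add; rewrite -!/(loc_frac _).
have [t St tu] := loc_repr u; have [r Sr rv] := loc_repr v.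
apply/loc_fracP; exists (t * r); first by rewrite rpredM.
move: (repr (loc_frac u)) (repr (loc_frac v)) tu rv => u' v'; rewrite /num /den /= => tu rv.
transitivity (r * (den v * den v') * (t * (num u * den u')) +
              t * (den u * den u') * (r * (num v * den v'))).
  by rewrite /num /den /=; ring.
by rewrite tu rv /num /den /=; ring.
Qed.

Lemma loc_fracN : {morph loc_frac : u / prefrac_opp u >-> loc_opp u}.
Proof.
move=> u; unlock loc_opp; rewrite -!/(loc_frac _).
have [t St tu] := loc_repr u; apply/loc_fracP; exists t => //.
move: (repr _) tu => u'; rewrite /num /den /= => tu.
by rewrite !mulNr !mulrN tu.
Qed.

Lemma loc_fracM : {morph loc_frac : u v / prefrac_mul u v >-> loc_mul u v}.
Proof.
move=> u v; unlock loc_mul; rewrite -!/(loc_frac _).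
have [t St tu] := loc_repr u; have [r Sr rv] := loc_repr v.
apply/loc_fracP; exists (t * r); first by rewrite rpredM.
move: (repr (loc_frac u)) (repr (loc_frac v)) tu rv => u' v'; rewrite /num /den /= => tu rv.
transitivity ((t * (num u * den u')) * (r * (num v * den v'))).
  by rewrite /num /den /=; ring.
by rewrite tu rv /num /den /=; ring.
Qed.

Lemma loc_frac_eq u v : num u * den v = num v * den u -> loc_frac u = loc_frac v.
Proof. by move=> uv; apply/loc_fracP; exists 1; rewrite ?rpred1 ?uv. Qed.

Local Ltac loc_ring :=
  apply: loc_frac_eq;
  rewrite ?/prefrac_add ?/prefrac_opp ?/prefrac_mul /num /den /=; ring.

Lemma loc_addA : associative loc_add.
Proof.
elim/loc_fracW=> u; elim/loc_fracW=> v; elim/loc_fracW=> w.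
by rewrite -!loc_fracD; loc_ring.
Qed.

Lemma loc_addC : commutative loc_add.
Proof.
elim/loc_fracW=> u; elim/loc_fracW=> v.
by rewrite -!loc_fracD; loc_ring.
Qed.

Lemma loc_add0 : left_id (to_loc 0) loc_add.
Proof.
elim/loc_fracW=> u.
by rewrite -loc_fracD; loc_ring.
Qed.

Lemma loc_addN : left_inverse (to_loc 0) loc_opp loc_add.
Proof.
elim/loc_fracW=> u; rewrite -loc_fracN -loc_fracD.
by loc_ring.
Qed.

HB.instance Definition _ :=
  GRing.isZmodule.Build localization loc_addA loc_addC loc_add0 loc_addN.

Lemma loc_mulA : associative loc_mul.
Proof.
elim/loc_fracW=> u; elim/loc_fracW=> v; elim/loc_fracW=> w.
by rewrite -!loc_fracM; loc_ring.
Qed.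

Lemma loc_mulC : commutative loc_mul.
Proof.
elim/loc_fracW=> u; elim/loc_fracW=> v.
by rewrite -!loc_fracM; loc_ring.
Qed.

Lemma loc_mul1 : left_id (to_loc 1) loc_mul.
Proof.
elim/loc_fracW=> u.
by rewrite -loc_fracM; loc_ring.
Qed.

Lemma loc_mulDl : left_distributive loc_mul +%R.
Proof.
elim/loc_fracW=> u; elim/loc_fracW=> v; elim/loc_fracW=> w.
rewrite -[RHS]/(loc_add _ _) -[_ + _]/(loc_add _ _) -!loc_fracM -!loc_fracD.
by rewrite -loc_fracM; loc_ring.
Qed.

HB.instance Definition _ := GRing.Zmodule_isComPzRing.Build localization
  loc_mulA loc_mulC loc_mul1 loc_mulDl.

End Localization.

Section PrimeLocalization.
Variables (A : comPzRingType) (P : ideal A) (primeP : prime_ideal P).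

Lemma prime_compl_mulr : mulr_closed [predC P].
Proof.
split=> [|x y nPx nPy]; rewrite inE; first exact: primeP.1.
apply/negP => /(primeP.2 x y) /orP[] Pz.
  by rewrite inE Pz in nPx.
by rewrite inE Pz in nPy.
Qed.

Definition prime_compl : mulrClosed A :=
  HB.pack ([predC P] : {pred A}) (GRing.isMulClosed.Build A _ prime_compl_mulr).

Definition local_ring : comPzRingType := localization prime_compl.

End PrimeLocalization.

Definition integral_domain (R : comPzRingType) : Prop :=
  1 != 0 :> R /\ GRing.integral_domain_axiom R.

(* An [idomainType] carries a chosen inverse function; passing to an isomorphic
   one gives access to the library's field of fractions. *)
Definition valuation_ring (R : comPzRingType) : Prop :=
  exists2 V : idomainType, ring_isomorphic R V &
    forall x : {fraction V},
      exists a : V, x = FracField.tofrac a \/ x^-1 = FracField.tofrac a.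

Definition pruefer_domain (D : comPzRingType) : Prop :=
  integral_domain D /\
  forall (P : ideal D) (primeP : prime_ideal P),
    valuation_ring (local_ring primeP).

(* Main.v *)
From HB Require Import structures.
Require Import Defs.
From mathcomp Require Import all_boot all_algebra.
From mathcomp Require Import fraction boolp ring.

Set Implicit Arguments.
Unset Strict Implicit.
Unset Printing Implicit Defensive.

Import GRing.Theory.

Local Open Scope ring_scope.

(* A finitely generated ideal is projective iff it has a dual basis: linear
   coordinate functionals recovering each element from the generators. For a
   principal ideal this makes the annihilator of [x] generated by an idempotent
   [e], and [x + e] is regular; so if [x] lies in a prime [P] of zero divisors,
   then [1 - e] lies in [P] and [x = (1 - e) x] is in [P^2]. If [P] is finitely
   generated, a join of such idempotents generates it. Dual bases of ideals with
   two generators make [A/P] locally a valuation ring. *)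

(** * Dual bases and projectivity of finitely generated ideals *)

Section DualBasis.
Variable A : comPzRingType.
Implicit Types (I : ideal A) (s : seq A).

(* The functionals are total on [A], but only their values on [I] matter. *)
Definition dual_basis I s : Prop :=
  exists phi : nat -> A -> A,
    (forall i a x y, x \in I -> y \in I ->
       phi i (a * x + y) = a * phi i x + phi i y) /\
    (forall x, x \in I -> x = \sum_(i < size s) phi i x * s`_i).

Lemma gen_ideal_nth s i : (i < size s)%N -> s`_i \in gen_ideal s.
Proof.
move=> lt_i; apply/asboolP; exists (fun j => (j == i)%:R).
rewrite (bigD1 (Ordinal lt_i)) //= eqxx mul1r big1 ?addr0 // => j.
by rewrite -val_eqE /= => /negPf ->; rewrite mul0r.
Qed.

Lemma principal_idealP (a x : A) :
  reflect (exists c, x = c * a) (x \in principal_ideal a).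
Proof.
apply: (iffP (asboolP _)) => [[c ->]|[c ->]].
  by exists (c 0); rewrite big_ord1.
by exists (fun=> c); rewrite big_ord1.
Qed.

(** Projectivity splits the surjection from the free module of rows onto [I]; the coordinates of the
    section are the functionals. *)
Lemma projective_dual_basis I s :
  I =i gen_ideal s -> projective (ideal_module I) -> dual_basis I s.
Proof.
move=> Is projI.
have comb_mem (v : 'rV[A]_(size s)) :
    (\sum_(i < size s) v 0 i * s`_i : A^o) \in ideal_regular I.
  rewrite unfold_in; apply: rpred_sum => i _; apply: ideal_mull.
  by rewrite Is gen_ideal_nth.
pose comb v : ideal_module I := IdealModule (comb_mem v).
have comb_lin : linear comb.
  move=> a u v; apply: val_inj => /=; rewrite scaler_sumr -big_split /=.
  by apply: eq_bigr => i _; rewrite !mxE mulrDl -mulrA.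
pose g : {linear 'rV[A]_(size s) -> ideal_module I} :=
  HB.pack comb (GRing.isLinear.Build _ _ _ _ comb comb_lin).
have g_surj y : exists x, g x = y.
  have := valP y; rewrite unfold_in Is => /asboolP[c def_y].
  exists (\row_i c i); apply: val_inj; rewrite /= [RHS]def_y.
  by apply: eq_bigr => i _; rewrite mxE.
have [h gh] := projI _ _ g (idfun : {linear _ -> _}) g_surj.
(* [insubd] replaces an element outside [I] by 0, which makes [coords] total. *)
pose coords (x : A) : 'rV[A]_(size s) := h (insubd (0 : ideal_module I) (x : A^o)).
have ivK x : x \in I -> val (insubd (0 : ideal_module I) (x : A^o)) = x.
  by move=> Ix; rewrite insubdK.
exists (fun i x => if insub i is Some j then coords x 0 j else 0); split.
  move=> i a x y Ix Iy; case: insubP => [j _ _|_]; last by rewrite mulr0 addr0.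
  have Iaxy : a * x + y \in I by rewrite rpredD ?ideal_mull.
  suff -> : coords (a * x + y) = a *: coords x + coords y by rewrite !mxE.
  rewrite /coords -linearP; congr (h _); apply: val_inj.
  by rewrite ivK //= !ivK.
move=> x Ix; rewrite -[LHS]ivK // -[insubd _ _]gh /=.
by apply: eq_bigr => i _; rewrite valK.
Qed.

(** Choose preimages under [g] of the images of the generators; weighting them by the functionals
    gives the lift. *)
Lemma dual_basis_projective I s :
  {subset s <= I} -> dual_basis I s -> projective (ideal_module I).
Proof.
move=> sI [phi [phi_lin phi_sum]] N N' g f g_surj.
have sIn (i : 'I_(size s)) : (s`_i : A^o) \in ideal_regular I.
  by rewrite unfold_in sI ?mem_nth.
pose b i : ideal_module I := IdealModule (sIn i).
have [n gn] := choice (fun i => g_surj (f (b i))).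
pose h0 (x : ideal_module I) : N := \sum_(i < size s) phi i (val x) *: n i.
have h0_lin : linear h0.
  move=> a x y; rewrite /h0 scaler_sumr -big_split /=; apply: eq_bigr => i _.
  rewrite scalerA -scalerDl -phi_lin //; [exact: (valP x)|exact: (valP y)].
pose h : {linear ideal_module I -> N} :=
  HB.pack h0 (GRing.isLinear.Build _ _ _ _ h0 h0_lin).
exists h => x; rewrite /= /h0 linear_sum.
under eq_bigr do rewrite linearZ /= gn -linearZ.
rewrite -linear_sum; congr (f _); apply: val_inj.
rewrite raddf_sum /= [RHS]phi_sum; last exact: (valP x).
by apply: eq_bigr.
Qed.

Lemma linear_on_scale I (f : A -> A) :
  (forall a x y, x \in I -> y \in I -> f (a * x + y) = a * f x + f y) ->
  forall a, {in I, forall x, f (a * x) = a * f x}.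
Proof.
move=> f_lin a x Ix; have f0 : f 0 = 0.
  have := f_lin (-1) 0 0 (rpred0 _) (rpred0 _).
  by rewrite mulr0 addr0 mulN1r addNr.
by have := f_lin a x 0 Ix (rpred0 _); rewrite f0 !addr0.
Qed.

Lemma semi_hereditary_dual_basis s :
  semi_hereditary A -> dual_basis (gen_ideal s) s.
Proof.
by move=> hA; apply: projective_dual_basis => //; apply: hA; exists s.
Qed.

End DualBasis.

(** * Idempotents inside a prime of zero divisors *)

Section AnnihilatorIdempotent.
Variable A : comPzRingType.
Hypothesis hA : semi_hereditary A.

(** The single functional on [(x)] satisfies [x = phi x * x], so [1 - phi x] kills [x]. If
    [y * x = 0], then [y * phi x = phi (y * x) = 0]; taking [y = 1 - phi x] gives idempotence. *)
Lemma annihilator_idempotent (x : A) :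
  exists e, [/\ e * e = e, e * x = 0 & forall y, y * x = 0 -> y = y * e].
Proof.
have [phi [phi_lin phi_sum]] := semi_hereditary_dual_basis [:: x] hA.
have Ix : x \in gen_ideal [:: x] by apply/principal_idealP; exists 1; rewrite mul1r.
have phiM a : phi 0%N (a * x) = a * phi 0%N x by apply: (linear_on_scale (phi_lin 0%N)).
have phi0 : phi 0%N 0 = 0 by rewrite -[X in phi _ X](mul0r x) phiM mul0r.
have := phi_sum x Ix; rewrite big_ord1 /= => def_x; exists (1 - phi 0%N x).
have ex : (1 - phi 0%N x) * x = 0 by rewrite mulrBl mul1r -def_x subrr.
have ann y : y * x = 0 -> y = y * (1 - phi 0%N x).
  by move=> yx; rewrite mulrBr mulr1 -phiM yx phi0 subr0.
by split=> //; rewrite -ann.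
Qed.

Variables (P : ideal A) (primeP : prime_ideal P).
Hypothesis zdP : forall x : A, x \in P -> zero_divisor x.

(* With [e] generating the annihilator of [x], the element [x + e] is regular,
   so it lies outside [P]; hence [1 - e] lies in [P]. *)
Lemma prime_zero_divisor_idempotent x :
  x \in P -> exists f, [/\ f \in P, f * f = f & x = f * x].
Proof.
move=> Px; have [e [ee ex ann]] := annihilator_idempotent x.
have nPe : e \notin P.
  apply/negP=> Pe; case: (zdP (rpredD Px Pe)) => y z; move/eqP.
  rewrite -subr_eq0 -mulrBr; set d := y - z => /eqP xed.
  (* Multiplying [(x + e) * d = 0] by [e] leaves [e * d = 0]; then [d * x = 0], and so
     [d = d * e = 0]. *)
  have ed : e * d = 0.
    transitivity (e * ((x + e) * d)); last by rewrite xed mulr0.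
    by rewrite mulrA [e * (x + e)]mulrDr ex add0r ee.
  have dx : d * x = 0 by move: xed; rewrite mulrDl ed addr0 mulrC.
  by apply/eqP; rewrite -subr_eq0 -/d (ann d dx) mulrC ed.
exists (1 - e); split; last by rewrite mulrBl mul1r ex subr0.
  have : e * (1 - e) \in P by rewrite mulrBr mulr1 ee subrr rpred0.
  by case/primeP.2/orP => // Pe; rewrite Pe in nPe.
by rewrite mulrBr mulr1 mulrBl mul1r ee subrr subr0.
Qed.

Lemma prime_zero_divisor_square : mul_ideal P P =i P.
Proof.
move=> x; apply/idP/idP.
  case/asboolP=> n [a [b [_ Pb ->]]].
  by apply: rpred_sum => i _; apply: ideal_mull.
move=> Px; have [f [Pf _ def_x]] := prime_zero_divisor_idempotent Px.
by apply/asboolP; exists 1%N, (fun=> f), (fun=> x); split; rewrite ?big_ord1.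
Qed.

(** By induction, using the join [e + f - e * f], which fixes whatever [e] or [f] fixes. *)
Lemma prime_zero_divisor_common_idempotent (s : seq A) :
  {subset s <= P} ->
  exists e, [/\ e \in P, e * e = e & {in s, forall x, x = e * x}].
Proof.
elim: s => [|x s IHs] sP; first by exists 0; rewrite rpred0 mulr0.
have [|e [Pe ee eE]] := IHs; first by move=> y sy; apply: sP; rewrite inE sy orbT.
have [|f [Pf ff fx]] := @prime_zero_divisor_idempotent x.
  by apply: sP; rewrite mem_head.
exists (e + f - e * f); split.
- by rewrite rpredB ?rpredD ?ideal_mull.
(* The square is expanded so that [e * e] and [f * f] appear literally and can be rewritten. *)
- transitivity (e * e + f * f + (e * f) *+ 2 + (e * e) * (f * f)
                 - (e * e) * f *+ 2 - e * (f * f) *+ 2); first by ring.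
  by rewrite ee ff; ring.
move=> y; rewrite inE => /predU1P[->|/eE def_y].
  transitivity (e * x + f * x - e * (f * x)); last by ring.
  by rewrite -fx; ring.
transitivity (e * y + f * y - f * (e * y)); last by ring.
by rewrite -def_y; ring.
Qed.

Lemma prime_zero_divisor_principal :
  finitely_generated P ->
  exists e, [/\ e \in P, e * e = e & P =i principal_ideal e].
Proof.
case=> s Ps; have [|e [Pe ee eE]] := @prime_zero_divisor_common_idempotent s.
  by move=> x /(nthP 0)[i lt_i <-]; rewrite Ps gen_ideal_nth.
exists e; split=> // x; apply/idP/principal_idealP => [|[c ->]].
  (* Since [e] fixes every generator, it fixes the element itself, which thus serves as its own
     coefficient. *)
  rewrite Ps => /asboolP[c ->]; exists (\sum_(i < size s) c i * s`_i).
  rewrite mulr_suml; apply: eq_bigr => i _.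
  by rewrite {1}[s`_i]eE ?mem_nth // [e * _]mulrC mulrA.
by rewrite ideal_mull.
Qed.

End AnnihilatorIdempotent.

(** * Valuation rings through total divisibility *)

Lemma integral_domain_idomainType (R : comPzRingType) :
  integral_domain R -> exists V : idomainType, ring_isomorphic R V.
Proof.
case=> R1 domR; pose unit : {pred R} := fun x => `[< exists y, y * x = 1 >].
(* Inverses are chosen classically, with the identity as default on non-units. *)
have /choice[inv invP] x : exists y, if x \in unit then y * x = 1 else y = x.
  by case Ux: (x \in unit); [apply: (asboolW Ux) | exists x].
pose W : comNzRingType := HB.pack (R : Type) R
  (GRing.PzSemiRing_isNonZero.Build R R1).
have mulVx : {in (unit : {pred W}), left_inverse 1 inv *%R}.
  by move=> x Ux; have := invP x; rewrite Ux.
have unitPl (x y : W) : y * x = 1 -> unit x by move=> yx; apply/asboolP; exists y.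
have invr_out : {in [predC (unit : {pred W})], inv =1 id}.
  by move=> x /negPf Ux; have := invP x; rewrite Ux.
pose mulInv := GRing.ComNzRing_hasMulInverse.Build W mulVx unitPl invr_out.
pose U : comUnitRingType := HB.pack (R : Type) W mulInv.
pose V : idomainType := HB.pack (R : Type) U (GRing.ComUnitRing_isIntegral.Build U domR).
exists V; exists (idfun : {rmorphism R -> R}); exact: (Bijective (g := idfun)).
Qed.

Lemma fractionP (V : idomainType) (x : {fraction V}) :
  exists a b : V, b != 0 /\ x = FracField.tofrac a / FracField.tofrac b.
Proof.
elim/quotW: x => r; exists (frac r).1, (frac r).2; split.
  exact: denom_ratioP.
have nzFd : FracField.tofrac (frac r).2 != 0 by rewrite tofrac_eq0 denom_ratioP.
apply: (canRL (mulfK nzFd)).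
unlock FracField.tofrac; rewrite -[LHS]FracField.pi_mul.
apply/eqmodP; rewrite /= FracField.equivfE /FracField.mulf.
by rewrite !numden_Ratio ?mulf_neq0 ?oner_eq0 ?denom_ratioP // !mulr1 mulrC.
Qed.

(** For a fraction [a / b]: if [b] divides [a] it lies in the ring, and if [a] divides [b] its
    inverse does. *)
Lemma valuation_ring_divides (R : comPzRingType) :
  integral_domain R ->
  (forall x y : R, (exists c, x = c * y) \/ (exists c, y = c * x)) ->
  valuation_ring R.
Proof.
move=> /integral_domain_idomainType[V [f [g fK gK]]] total_dvd.
exists V; first by exists f, g.
move=> x; have [a [b [nzb ->]]] := fractionP x.
have nzFb : FracField.tofrac b != 0 by rewrite tofrac_eq0.
have [[c gac]|[c gbc]] := total_dvd (g a) (g b); exists (f c).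
  by left; rewrite -[a]gK gac rmorphM gK tofracM mulfK.
have def_b : b = f c * a by rewrite -[b]gK gbc rmorphM gK.
right; rewrite invf_div {1}def_b tofracM mulfK // tofrac_eq0.
by apply: contraNneq nzb => a0; rewrite def_b a0 mulr0.
Qed.

(** * Localization of a domain at a prime *)

Section PrimeLocalizationDomain.
Variables (D : comPzRingType) (domD : integral_domain D).
Variables (Q : ideal D) (primeQ : prime_ideal Q).
Local Notation S := (prime_compl primeQ).

Lemma prime_compl_neq0 t : t \in S -> t != 0.
Proof. by apply: contraTneq => ->; rewrite inE rpred0. Qed.

(** The auxiliary factor [t] lies outside [Q], hence is nonzero and cancels. *)
Lemma local_ring_fracP (u v : prefrac S) :
  loc_frac u = loc_frac v <-> num u * den v = num v * den u.
Proof.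
split=> [/loc_fracP[t St]|]; last exact: loc_frac_eq.
move/eqP; rewrite -subr_eq0 -mulrBr => /eqP/domD.2.
by rewrite (negPf (prime_compl_neq0 St)) subr_eq0 => /eqP.
Qed.

Lemma local_ring_integral_domain : integral_domain (local_ring primeQ).
Proof.
split=> [|x y].
  apply/eqP => /local_ring_fracP; rewrite /num /den /= !mulr1.
  by apply/eqP; apply: domD.1.
elim/loc_fracW: x => u; elim/loc_fracW: y => v.
rewrite -[_ * _]/(loc_mul _ _) -loc_fracM => /local_ring_fracP.
rewrite /= mulr1 [RHS]mul0r => /domD.2 /orP[] /eqP num0; apply/orP;
  [left|right]; apply/eqP/local_ring_fracP; by rewrite [num _]num0 mul0r [RHS]mul0r.
Qed.

End PrimeLocalizationDomain.

(* [p], [q], [r], [s] are the values at [a] and [b] of the two coordinate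
   functionals of a projective ideal [(a, b)]; in a domain [p + s = 1], so at
   every prime one of [p], [s] becomes invertible and one of [a], [b] divides
   the other. *)
Lemma pruefer_domain_coordinates (D : comPzRingType) :
  integral_domain D ->
  (forall a b : D, exists p q r s : D,
     [/\ a = p * a + q * b, b * p = a * r & b * q = a * s]) ->
  pruefer_domain D.
Proof.
move=> domD coords; split=> // Q primeQ.
apply: valuation_ring_divides => [|x y]; first exact: local_ring_integral_domain.
elim/loc_fracW: x => u; elim/loc_fracW: y => v.
(* The multiplier of [w'] is the fraction [c / t]. *)
have fracE t (St : t \in prime_compl primeQ) c (w w' : prefrac (prime_compl primeQ)) :
    num w * den w' * t = num w' * den w * c ->
    exists d : local_ring primeQ, loc_frac w = d * loc_frac w'.
  move=> ww'; exists (loc_frac (prefrac_of c St)).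
  rewrite -[_ * _]/(loc_mul _ _) -loc_fracM; apply: loc_frac_eq.
  rewrite -[LHS]/(num w * (t * den w')) -[RHS]/(c * num w' * den w).
  by transitivity (num w * den w' * t); [ring | rewrite ww'; ring].
(* Cross-multiplication turns the two fractions into elements of [D] over a common denominator. *)
have [p [q [r [s [a_eq bp bq]]]]] := coords (num u * den v) (num v * den u).
have [u0|nzu] := eqVneq (num u * den v) 0.
  by left; apply: (fracE 1 (rpred1 _) 0); rewrite u0 mul0r mulr0.
have ps1 : p + s = 1.
  apply/eqP; rewrite -subr_eq0.
  have /domD.2 : (num u * den v) * (p + s - 1) = 0.
    by rewrite mulrBr mulr1 mulrDr -bq [_ * p]mulrC [_ * q]mulrC -a_eq subrr.
  by rewrite (negPf nzu).
have [Qp|nQp] := boolP (p \in Q); last by right; apply: (fracE p nQp r).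
have nQs : s \notin Q.
  by apply: contra primeQ.1 => Qs; rewrite -ps1 rpredD.
by left; apply: (fracE s nQs q).
Qed.

(** * Quotients by an ideal, and the Prüfer property *)

Section Quotient.
Variables (A : comPzRingType) (I : ideal A).

Lemma quot_proj_is_zmod_morphism : zmod_morphism (@quot_proj A I).
Proof.
by move=> x y; apply/eqP; rewrite eq_sym subr_eq -quot_projD subrK.
Qed.

Lemma quot_proj_is_monoid_morphism : monoid_morphism (@quot_proj A I).
Proof. by split; last exact: quot_projM. Qed.

HB.instance Definition _ := GRing.isZmodMorphism.Build A (quot_ring I)
  (@quot_proj A I) quot_proj_is_zmod_morphism.
HB.instance Definition _ := GRing.isMonoidMorphism.Build A (quot_ring I)
  (@quot_proj A I) quot_proj_is_monoid_morphism.

Lemma quot_proj_eq0 x : (quot_proj I x == 0) = (x \in I).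
Proof.
by rewrite -(rmorph0 (@quot_proj A I)) -[in RHS](subr0 x);
  apply/eqP/idP => /quot_projP.
Qed.

Lemma quot_projK (u : quot_ring I) : quot_proj I (repr u) = u.
Proof. exact: reprK. Qed.

Lemma quot_integral_domain : prime_ideal I -> integral_domain (quot_ring I).
Proof.
case=> nI1 primeI; split.
  by rewrite -(rmorph1 (@quot_proj A I)) quot_proj_eq0.
elim/quot_projW=> x; elim/quot_projW=> y; rewrite -rmorphM => /eqP.
by rewrite !quot_proj_eq0; apply: primeI.
Qed.

(** The relations already hold in [A], because [b * phi i a = phi i (a * b) = a * phi i b]; they are
    then reduced modulo [I]. *)
Lemma quot_pruefer_domain :
  semi_hereditary A -> prime_ideal I -> pruefer_domain (quot_ring I).
Proof.
move=> hA /quot_integral_domain domI; apply: pruefer_domain_coordinates => //.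
elim/quot_projW=> a; elim/quot_projW=> b.
have [phi [phi_lin phi_sum]] := semi_hereditary_dual_basis [:: a; b] hA.
have Ja : a \in gen_ideal [:: a; b] by apply: (@gen_ideal_nth _ [:: a; b] 0).
have Jb : b \in gen_ideal [:: a; b] by apply: (@gen_ideal_nth _ [:: a; b] 1).
have phiC i : b * phi i a = a * phi i b.
  by rewrite -!(linear_on_scale (phi_lin i)) // mulrC.
exists (quot_proj I (phi 0%N a)), (quot_proj I (phi 1%N a)),
       (quot_proj I (phi 0%N b)), (quot_proj I (phi 1%N b)).
rewrite -!rmorphM -!rmorphD !phiC; split=> //.
by rewrite {1}[a]phi_sum // big_ord_recl big_ord1.
Qed.

End Quotient.

(** * Splitting the ring along an idempotent *)

Section IdempotentDecomposition.
Variables (A : comPzRingType) (e : A).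
Hypothesis ee : e * e = e.
Local Notation Q0 := (quot_ring (principal_ideal e)).
Local Notation Q1 := (quot_ring (principal_ideal (1 - e))).

Lemma idempotent_decomposition : ring_isomorphic A (Q0 * Q1)%type.
Proof.
pose f (x : A) : Q0 * Q1 :=
  (quot_proj (principal_ideal e) x, quot_proj (principal_ideal (1 - e)) x).
have fB : zmod_morphism f by move=> x y; rewrite /f !rmorphB.
have fM : monoid_morphism f.
  by split; [rewrite /f !rmorph1 | move=> x y; rewrite /f !rmorphM].
pose F : {rmorphism A -> Q0 * Q1} := HB.pack f
  (GRing.isZmodMorphism.Build _ _ f fB) (GRing.isMonoidMorphism.Build _ _ f fM).
(* Modulo [e] the element [1 - e] is 1, and modulo [1 - e] it is 0; [e] behaves the other way
   round. *)
exists F; exists (fun u => (1 - e) * repr u.1 + e * repr u.2) => [x|[u v]] /=.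
  have /quot_projP/principal_idealP[c c_eq] :=
    quot_projK (quot_proj (principal_ideal e) x).
  have /quot_projP/principal_idealP[d d_eq] :=
    quot_projK (quot_proj (principal_ideal (1 - e)) x).
  rewrite -[repr (quot_proj _ _)](subrK x) c_eq -[X in e * X](subrK x) d_eq.
  transitivity (x + c * (e - e * e) + d * (e - e * e)); first by ring.
  by rewrite ee subrr !mulr0 !addr0.
rewrite /f; congr (_, _).
  rewrite -[RHS]quot_projK; apply/quot_projP/principal_idealP.
  by exists (repr v - repr u); ring.
rewrite -[RHS]quot_projK; apply/quot_projP/principal_idealP.
by exists (repr u - repr v); ring.
Qed.

Lemma quot_proj_idempotent x :
  quot_proj (principal_ideal (1 - e)) (e * x) = quot_proj (principal_ideal (1 - e)) x.
Proof. by apply/quot_projP/principal_idealP; exists (- x); ring. Qed.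

(** As [e * (1 - e) = 0], multiplying a representative by [e] gives a lift that depends only on the
    class. *)
Lemma quot_proj_idempotent_eq x y :
  quot_proj (principal_ideal (1 - e)) x = quot_proj (principal_ideal (1 - e)) y ->
  e * x = e * y.
Proof.
case/quot_projP/principal_idealP=> c xy; apply/eqP.
by rewrite -subr_eq0 -mulrBr xy mulrCA mulrBr mulr1 ee subrr mulr0.
Qed.

(* An ideal of [A/(1-e)A] lifts to the ideal of [A] generated by [e] times
   representatives, and its coordinate functionals are induced from there. *)
Lemma quot_semi_hereditary : semi_hereditary A -> semi_hereditary Q1.
Proof.
move=> hA I [s Is]; pose pi := @quot_proj A (principal_ideal (1 - e)).
pose t := [seq e * repr x | x <- s].
have tE i : (i < size s)%N -> t`_i = e * repr s`_i.
  by move=> lt_i; rewrite (nth_map 0).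
have [phi [phi_lin phi_sum]] := semi_hereditary_dual_basis t hA.
have piE (x : Q1) : pi (e * repr x) = x by rewrite [LHS]quot_proj_idempotent quot_projK.
have lift_mem x : x \in I -> e * repr x \in gen_ideal t.
  rewrite Is => /asboolP[c def_x].
  (* Both sides are multiples of [e], so it suffices to compare classes modulo [1 - e]. *)
  have -> : e * repr x = e * \sum_(i < size s) repr (c i) * (e * repr s`_i).
    apply: quot_proj_idempotent_eq; rewrite quot_projK def_x rmorph_sum.
    by apply: eq_bigr => i _; rewrite rmorphM /= quot_projK -[RHS]/(_ * pi _) piE.
  apply/ideal_mull/rpred_sum => i _; apply: ideal_mull.
  by rewrite -tE // gen_ideal_nth // size_map.
apply: (@dual_basis_projective _ I s).
  by move=> x /(nthP 0)[i lt_i <-]; rewrite Is gen_ideal_nth.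
exists (fun i x => pi (phi i (e * repr x))); split.
  move=> i a x y Ix Iy.
  have -> : e * repr (a * x + y) = repr a * (e * repr x) + e * repr y.
    have -> : repr a * (e * repr x) + e * repr y = e * (repr a * repr x + repr y) by ring.
    by apply: quot_proj_idempotent_eq; rewrite rmorphD rmorphM /= !quot_projK.
  by rewrite phi_lin ?lift_mem // /pi rmorphD rmorphM /= quot_projK.
move=> x Ix; rewrite -{1}[x]piE {1}[e * _]phi_sum ?lift_mem // /pi rmorph_sum size_map.
by apply: eq_bigr => i _; rewrite rmorphM tE // -[LHS]/(_ * pi _) piE.
Qed.

End IdempotentDecomposition.

Theorem proposition5p2 (A : comPzRingType) (hA : semi_hereditary A)
    (P : ideal A) (primeP : prime_ideal P)
    (zdP : forall x : A, x \in P -> zero_divisor x) :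
  mul_ideal P P =i P /\
  (finitely_generated P ->
   exists e : A,
     [/\ e \in P, e * e = e & P =i principal_ideal e] /\
     [/\ ring_isomorphic A (quot_ring (principal_ideal e) *
                            quot_ring (principal_ideal (1 - e)))%type,
         pruefer_domain (quot_ring (principal_ideal e))
       & semi_hereditary (quot_ring (principal_ideal (1 - e)))]).
Proof.
split; first exact: prime_zero_divisor_square.
case/(prime_zero_divisor_principal hA primeP zdP) => e [Pe ee defP].
exists e; split=> //; split.
- exact: idempotent_decomposition.
- apply: quot_pruefer_domain => //.
  (* Primality is transported from [P] to [(e)] along equality of membership. *)
  by case: primeP => nP1 primeP'; split=> [|x y]; rewrite -!defP //; apply: primeP'.
- exact: quot_semi_hereditary.
Qed.
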